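(* Let $G=U(C_l;T_1,T_2,\ldots,T_l)$ be a graph in $\mathscr{U}_{n,l}$, and let $x\in V_{T_k}$ for some $k\in\{1,\ldots,l\}$. Then (i) $CC(x)=2K\!f(G)+\sum_{i=1}^l D_{T_i}(v_i)-n\,d(x,v_k)$; (ii) $RC(x)=2nR(x)-2K\!f(G)-\sum_{i=1}^l D_{T_i}(v_i)+n\,d(x,v_k)$.
   Context: All graphs are finite, simple and undirected; $V_G,E_G$ are the vertex and edge sets of $G$, $d(x)$ is the degree of a vertex $x$, and $d(x,y)$ is the graph distance. A unicyclic graph is a connected graph $G$ with $|V_G|=|E_G|$ (so it has exactly one cycle). $\mathscr{U}_{n,l}$ is the set of all unicyclic graphs on $n$ vertices whose unique cycle is $C_l$ (the cycle of length $l$). Writing $G=U(C_l;T_1,\ldots,T_l)$ means that $C_l=v_1v_2\ldots v_lv_1$ is the unique cycle of $G$ and $T_i$ is the component of $G-E_{C_l}$ (the graph obtained from $G$ by deleting the edges of the cycle) containing $v_i$; each $T_i$ is a tree. For a tree $T$ and $v\in V_T$, $D_T(v)=\sum_{y\in V_T}d_T(v,y)$. The resistance distance $r(x,y)$ is the effective resistance between $x$ and $y$ when each edge of $G$ is replaced by a unit resistor; $R(x)=\sum_{y\in V_G}r(x,y)$ and the Kirchhoff index is $K\!f(G)=\sum_{\{x,y\}\subseteq V_G}r(x,y)$ (sum over unordered pairs). The simple random walk on $G$ jumps from its current vertex $x$ to each neighbour of $x$ with probability $1/d(x)$; $H_{xy}$ is the expected value of $T_y=\inf\{k\ge 0: X_k=y\}$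 for the walk $(X_k)_{k\ge0}$ started at $X_0=x$. The cover cost and reverse cover cost of $x$ are $CC(x)=\sum_{y\in V_G}H_{xy}$ and $RC(x)=\sum_{y\in V_G}H_{yx}$. *)

(* Defs.v *)
From HB Require Import structures.
From mathcomp Require Import all_boot all_order all_algebra.
From mathcomp Require Import all_classical all_reals all_analysis.

Set Implicit Arguments.
Unset Strict Implicit.
Unset Printing Implicit Defensive.

Import Order.TTheory GRing.Theory Num.Theory.
Local Open Scope ring_scope.

Section Graphs.
Variables (V : finType) (e : rel V).

Definition simple_graph : Prop := symmetric e /\ irreflexive e.

Definition edges : {set {set V}} :=
  [set [set p.1; p.2]%SET | p in [pred p : V * V | e p.1 p.2]]%SET.

Definition degree (x : V) : nat := #|[set y | e x y]%SET|.

Definition connected_graph : Prop := forall x y : V, connect e x y.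

Definition unicyclic : Prop :=
  [/\ simple_graph, connected_graph & #|V| = #|edges|].

(* The length of a shortest path; a shortest path has fewer than #|V| edges,
   so the search range is sufficient.  The value is #|V| when there is none. *)
Definition graph_dist (x y : V) : nat :=
  find (fun k => [exists p : k.-tuple V, path e x p && (last x p == y)])
       (iota 0 #|V|).

(* The number of vertices is at least 3: as a cycle of the relation, an edge
   traversed back and forth would be a "cycle" of length 2. *)
Definition graph_cycle (c : seq V) : Prop := ucycle e c /\ (2 < size c)%N.

Definition cycle_edges (c : seq V) : {set {set V}} :=
  [set [set x; next c x]%SET | x in c]%SET.

Definition delete_edges (E : {set {set V}}) : rel V :=
  [rel x y | e x y && ([set x; y]%SET \notin E)].

Definition component (x : V) : {set V} := [set y | connect e x y]%SET.

Definition induced (A : {set V}) : rel V :=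
  [rel x y | [&& x \in A, y \in A & e x y]].

End Graphs.

(* A subgraph is a vertex set together with an edge relation on the ambient
   type: T_i has vertices [tree_verts e c i] and edges [tree_rel e c i]. *)
Section Trees.
Variables (V : finType) (e : rel V) (l : nat) (c : l.-tuple V) (i : 'I_l).

Definition tree_verts : {set V} :=
  component (delete_edges e (cycle_edges c)) (tnth c i).

Definition tree_rel : rel V :=
  induced (delete_edges e (cycle_edges c)) tree_verts.

End Trees.

(* D_T(v) for the subgraph T with vertex set A and edge relation t. *)
Definition dist_sum (V : finType) (A : {set V}) (t : rel V) (v : V) : nat :=
  (\sum_(y in A) graph_dist t v y)%N.

Section Resistance.
Variables (R : realType) (V : finType) (e : rel V).

(* Kirchhoff's current law, with Ohm's law on unit resistors, for the
   potential u when a unit current enters at x and leaves at y. *)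
Definition unit_current_potential (x y : V) (u : V -> R) : Prop :=
  forall z : V, \sum_(w | e z w) (u z - u w) = (z == x)%:R - (z == y)%:R.

(* In a connected graph such a potential exists and is unique up to an
   additive constant, so the set below is a singleton. *)
Definition resistance (x y : V) : R :=
  xget 0 [set u x - u y | u in [set u | unit_current_potential x y u]]%classic.

Definition resistance_sum (x : V) : R := \sum_(y : V) resistance x y.

(* Each unordered pair of distinct vertices is counted once, ordered by its
   rank in the enumeration of V. *)
Definition kirchhoff_index : R :=
  \sum_(p : V * V | (enum_rank p.1 < enum_rank p.2)%N) resistance p.1 p.2.

End Resistance.

Section RandomWalk.
Variables (R : realType) (V : finType) (e : rel V).

Definition transition (x y : V) : R := (e x y)%:R / (degree e x)%:R.

(* The Markov property is stated in product form, which avoids conditioning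
   on null events. *)
Definition simple_random_walk d (Omega : measurableType d)
    (P : probability Omega R) (X : nat -> Omega -> V) (x : V) : Prop :=
  [/\ forall (k : nat) (z : V), measurable [set w | X k w = z]%classic,
      P [set w | X 0%N w = x]%classic = 1%E &
      forall (k : nat) (s : nat -> V),
        P [set w | forall i : nat, (i <= k.+1)%N -> X i w = s i]%classic =
        (P [set w | forall i : nat, (i <= k)%N -> X i w = s i]%classic *
         (transition (s k) (s k.+1))%:E)%E].

End RandomWalk.

(* The infimum of the empty set is +oo. *)
Definition hitting_time (R : realType) (V : finType) (Omega : Type)
    (X : nat -> Omega -> V) (y : V) (w : Omega) : \bar R :=
  ereal_inf [set (k%:R)%:E | k in [set k : nat | X k w = y]]%classic.

(* X x is the walk started at x, under the probability P x. *)
Section Costs.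
Variables (R : realType) (V : finType) (d : measure_display).
Variables (Omega : measurableType d) (P : V -> probability Omega R).
Variable X : V -> nat -> Omega -> V.

Definition expected_hitting (x y : V) : \bar R :=
  (\int[P x]_w hitting_time R (X x) y w)%E.

Definition cover_cost (x : V) : \bar R :=
  (\sum_(y : V) expected_hitting x y)%E.

Definition reverse_cover_cost (x : V) : \bar R :=
  (\sum_(y : V) expected_hitting y x)%E.

End Costs.

(* Main.v *)
Require Import Defs.
From HB Require Import structures.
From mathcomp Require Import all_boot all_order all_algebra.
From mathcomp Require Import all_classical all_reals all_analysis.
From mathcomp Require Import measurable_realfun ring lra zify.

(** Everything follows from the graph Laplacian L = D - A and from the fact that
    on a connected graph the functions with L u = 0 are constant.

    The expected hitting times satisfy L H_{.y} = d - m delta_y, where m = 2n is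
    the sum of the degrees ([laplacian_hitting]); summing over y gives
    L CC = n d - 2n.  On the other hand, let f be the distance to the cycle.
    In a unicyclic graph L f = 2 - d ([laplacian_height]): off the cycle, a
    vertex has one neighbour closer to the cycle and its other neighbours
    farther; on the cycle, it has two neighbours at distance 0 and the others at
    distance 1.  Hence CC + n f is harmonic, so CC + n f = K for a constant K.

    The commute time identity H_{xy} + H_{yx} = 2n r(x, y) ([commute_time])
    shows that CC has sum 2n Kf over the vertices, so that K = 2 Kf + sum of f
    ([cover_sum]), and that RC = 2n R - CC ([reverse_cover_sum]).  Finally f(x)
    is d(x, v_k) on T_k, and the sum of f is the sum of the D_{T_i}(v_i)
    ([graph_dist_root], [sum_dist_sum]).

    The structure of the graph comes from a count.  Send a vertex of the cycle
    to the next one, and any other vertex to a neighbour closer to the cycle.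
    The edges from a vertex to its image are pairwise distinct and there are as many
    of them as vertices, so they are all the edges ([edge_successor]).

    On the probabilistic side, the solution h of the one-step equations with
    h(y) = 0 exists by linear algebra and is nonnegative by the minimum
    principle.  The Markov property gives
    P(T_y > 0) + ... + P(T_y > k-1) = h(x) - M_k, where 0 <= M_k <= c P(T_y > k)
    for a constant c; thus M_k tends to 0 and h(x) is the expectation of T_y
    ([integral_hitting_time]). *)

Set Implicit Arguments.
Unset Strict Implicit.
Unset Printing Implicit Defensive.

Import Order.TTheory GRing.Theory Num.Theory.
Import numFieldNormedType.Exports.
Local Open Scope ring_scope.

(** * Potential theory on a finite connected graph *)

Section Potential.
Variables (R : realType) (V : finType) (e : rel V).
Hypothesis e_sym : symmetric e.
Hypothesis e_conn : connected_graph e.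

(** The combinatorial Laplacian: [laplacian u x] is the net current leaving
    [x] when [u] is a potential on unit resistors, that is (L u)(x) with
    L = D - A.  Harmonic means that it vanishes. *)
Definition laplacian (u : V -> R) (x : V) : R := \sum_(w | e x w) (u x - u w).

Lemma laplacianE u x :
  laplacian u x = (degree e x)%:R * u x - \sum_(w | e x w) u w.
Proof.
rewrite /laplacian sumrB sumr_const /degree cardsE.
by rewrite -[u x *+ _]mulr_natl.
Qed.

Lemma laplacianD u v x :
  laplacian (fun z => u z + v z) x = laplacian u x + laplacian v x.
Proof.
by rewrite /laplacian -big_split; apply: eq_bigr => w _; rewrite opprD addrACA.
Qed.

Lemma laplacianZ a u x : laplacian (fun z => a * u z) x = a * laplacian u x.
Proof.
by rewrite /laplacian mulr_sumr; apply: eq_bigr => w _; rewrite mulrBr.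
Qed.

Lemma laplacian_sum (I : finType) (u : I -> V -> R) x :
  laplacian (fun z => \sum_i u i z) x = \sum_i laplacian (u i) x.
Proof.
rewrite /laplacian exchange_big; apply: eq_bigr => w _.
by rewrite sumrB.
Qed.

Lemma sum_laplacian u : \sum_x laplacian u x = 0.
Proof.
have E : \sum_x laplacian u x = - \sum_x laplacian u x.
  rewrite /laplacian [LHS](exchange_big_dep predT) //= -sumrN.
  apply: eq_bigr => w _; rewrite -sumrN.
  by apply: eq_big => [x|x _]; [rewrite e_sym | rewrite opprB].
by lra.
Qed.

(** Minimum principle: the minimum of a function that is superharmonic off [y]
    is attained at [y]. *)
Lemma superharmonic_ge0 (u : V -> R) (y : V) :
    (forall x, x != y -> 0 <= laplacian u x) -> u y = 0 ->
  forall x, 0 <= u x.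
Proof.
move=> sup uy0 x.
(* At a minimizer other than [y] every term of the Laplacian is nonpositive and
   their sum is nonnegative, so all neighbours are minimizers as well; following
   a path, [y] is a minimizer. *)
have [m mP] : exists m, forall z, u m <= u z.
  by case: (@arg_minP _ _ _ y predT u) => // m _ h; exists m => z; exact: h.
suff um0 : u m = 0 by rewrite -um0.
have /connectP[p] := e_conn m y.
elim: p m mP => [|w p IH] m mP /= => [_ <- //|/andP[emw pw] lw].
have [->//|mNy] := eqVneq m y.
suff umw : u w = u m by rewrite -umw; apply: IH => // z; rewrite umw.
have t_le0 z : e m z -> u m - u z <= 0 by rewrite subr_le0.
have lap0 : laplacian u m == 0.
  by rewrite eq_le sup // andbT; apply: sumr_le0 => z; exact: t_le0.
have : \sum_(z | e m z) (u z - u m) == 0.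
  rewrite -oppr_eq0 -sumrN (eq_bigr (fun z => u m - u z)) // => z _.
  by rewrite opprB.
rewrite psumr_eq0 => [/allP/(_ w (mem_index_enum w))|z emz]; last first.
  by rewrite subr_ge0.
by rewrite emw subr_eq0 => /eqP.
Qed.

Lemma harmonic_eq0 (u : V -> R) (y : V) :
    (forall x, x != y -> laplacian u x = 0) -> u y = 0 -> forall x, u x = 0.
Proof.
move=> har uy0 x; apply/eqP; rewrite eq_le; apply/andP; split; last first.
  by apply: (@superharmonic_ge0 u y) => // z /har ->.
rewrite -oppr_ge0 -mulN1r; apply: (@superharmonic_ge0 (fun z => -1 * u z) y).
  by move=> z zy; rewrite laplacianZ har // mulr0.
by rewrite uy0 mulr0.
Qed.

Lemma laplacian_cst a x : laplacian (fun=> a) x = 0.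
Proof. by rewrite /laplacian big1 // => w _; rewrite subrr. Qed.

Lemma harmonic_const (u : V -> R) :
  (forall x, laplacian u x = 0) -> forall x y, u x = u y.
Proof.
move=> har x y; apply/eqP; rewrite -subr_eq0; apply/eqP.
apply: (@harmonic_eq0 (fun z => u z + - u y) y); last exact: subrr.
by move=> z _; rewrite laplacianD har laplacian_cst addr0.
Qed.

(** The Dirichlet problem L h = g off [y], h(y) = 0 is a square linear system
    whose kernel is trivial by [harmonic_eq0]. *)
Lemma poisson_exists (g : V -> R) (y : V) :
  exists h : V -> R, h y = 0 /\ forall x, x != y -> laplacian h x = g x.
Proof.
pose A (u : {ffun V -> R^o}) : {ffun V -> R^o} :=
  [ffun x => if x == y then u x else laplacian u x].
have A_lin : linear A.
  move=> a u v; apply/ffunP => x; rewrite !ffunE.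
  case: ifP => // _; transitivity (laplacian (fun z => a * u z + v z) x).
    by apply: eq_bigr => w _; rewrite !ffunE.
  by rewrite laplacianD laplacianZ.
pose AL := GRing.isLinear.Build _ _ _ _ A A_lin.
pose A' : {linear _ -> _} := HB.pack A AL.
have ker0 : lker (linfun A') == 0%VS.
  apply/lker0P => u v; rewrite !lfunE /= => /eqP.
  rewrite -subr_eq0 => /eqP Auv; apply/eqP; rewrite -subr_eq0; apply/eqP.
  have {}Auv : A (u - v) = 0 by rewrite -[A]/(A' : _ -> _) linearB.
  have {}Auv x := congr1 (fun f : {ffun V -> R^o} => f x) Auv.
  apply/ffunP => x; rewrite [RHS]ffunE; apply: (@harmonic_eq0 (u - v) y).
    by move=> z zy; have := Auv z; rewrite !ffunE (negPf zy).
  by have := Auv y; rewrite !ffunE eqxx.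
pose b : {ffun V -> R^o} := [ffun x => if x == y then 0 else g x].
pose h := ((linfun A')^-1)%VF b.
have hb : A h = b.
  have := congr1 (fun f : 'End(_) => f b) (lker0_compfV ker0).
  by rewrite comp_lfunE !lfunE.
have {}hb x := congr1 (fun f : {ffun V -> R^o} => f x) hb.
exists h; split=> [|x xy].
  by have := hb y; rewrite !ffunE eqxx.
by have := hb x; rewrite !ffunE (negPf xy).
Qed.

(** The function x |-> H_{xy} characterized analytically: off [y] the one-step
    equation h(x) = 1 + (1/d(x)) * (sum of h over the neighbours of x) reads
    L h = d.  [integral_hitting_time] below identifies it with the expected
    hitting time. *)
Definition hitting_potential (y : V) (h : V -> R) : Prop :=
  [/\ h y = 0, forall x, x != y -> laplacian h x = (degree e x)%:R
    & forall x, 0 <= h x].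

Lemma hitting_potential_exists y : exists h, hitting_potential y h.
Proof.
have [h [hy hx]] := poisson_exists (fun x => (degree e x)%:R) y.
exists h; split=> //; apply: superharmonic_ge0 hy => x xy.
by rewrite hx.
Qed.

(** The value of the Laplacian at the target [y] is forced, because the values
    of a Laplacian sum to 0. *)
Lemma laplacian_hitting y h : hitting_potential y h ->
  forall x, laplacian h x =
    (degree e x)%:R - (x == y)%:R * \sum_z (degree e z)%:R.
Proof.
case=> hy hx _ x; have [->|xy] := eqVneq x y; last by rewrite hx // mul0r subr0.
have := sum_laplacian h; rewrite (bigD1 y) //= (eq_bigr _ hx) => E.
by rewrite mul1r [in RHS](bigD1 y) //=; lra.
Qed.

Lemma resistance_eq x y (u : V -> R) :
  unit_current_potential e x y u -> resistance R e x y = u x - u y.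
Proof.
move=> hu; apply: xget_unique; first by exists u.
move=> _ [v hv <-]; apply/eqP; rewrite -subr_eq0; apply/eqP.
have har z : laplacian (fun z => v z + -1 * u z) z = 0.
  rewrite laplacianD laplacianZ [laplacian u z]hu [laplacian v z]hv.
  by rewrite mulN1r subrr.
by have := harmonic_const har x y; rewrite !mulN1r; lra.
Qed.

(** The commute time identity: (H_{.y} - H_{.x}) divided by the sum of the
    degrees is a potential for a unit current from [x] to [y]. *)
Lemma commute_time x y hx hy :
    hitting_potential x hx -> hitting_potential y hy ->
  hy x + hx y = (\sum_z (degree e z)%:R) * resistance R e x y.
Proof.
move=> Hx Hy; set m := \sum_z _.
(* If the sum of the degrees vanishes, hitting potentials are harmonic, hence
   zero. *)
have [m0|mN0] := eqVneq m 0.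
  have lap0 y' h' : hitting_potential y' h' -> forall z, laplacian h' z = 0.
    move=> H z; rewrite (laplacian_hitting H) -/m m0 mulr0 subr0.
    move: m0 => /eqP; rewrite psumr_eq0 // => /allP.
    by move=> /(_ z (mem_index_enum z))/eqP.
  rewrite m0 mul0r (harmonic_const (lap0 _ _ Hx) y x).
  rewrite (harmonic_const (lap0 _ _ Hy) x y).
  by case: Hx => -> _ _; case: Hy => -> _ _; rewrite addr0.
rewrite (@resistance_eq x y (fun z => m^-1 * (hy z + -1 * hx z))); last first.
  move=> z; rewrite -/(laplacian _ z) laplacianZ laplacianD laplacianZ.
  rewrite (laplacian_hitting Hx) (laplacian_hitting Hy) -/m.
  by field.
case: Hx => -> _ _; case: Hy => -> _ _.
by field.
Qed.

End Potential.

(** * Distances in graphs *)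

Lemma find_iota (a : pred nat) n m :
  (m < n)%N -> a m -> (forall k, (k < m)%N -> ~~ a k) -> find a (iota 0 n) = m.
Proof.
move=> mn am min.
have ha : has a (iota 0 n) by apply/hasP; exists m => //; rewrite mem_iota.
have fn : (find a (iota 0 n) < n)%N.
  by rewrite -[X in (_ < X)%N](size_iota 0) -has_find.
apply/eqP; rewrite eqn_leq; apply/andP; split; rewrite leqNgt; apply/negP => lt.
  by have := before_find 0%N lt; rewrite nth_iota // am.
by have := nth_find 0%N ha; rewrite nth_iota // (negPf (min _ lt)).
Qed.

Lemma graph_distE (V : finType) (r : rel V) (x y : V) (p : seq V) :
    path r x p -> last x p = y -> (size p < #|V|)%N ->
    (forall q, path r x q -> last x q = y -> (size p <= size q)%N) ->
  graph_dist r x y = size p.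
Proof.
move=> rp lp sp min; apply: find_iota => //.
  by apply/existsP; exists (in_tuple p); rewrite rp lp eqxx.
move=> k kp; apply/existsP => -[q /andP[rq /eqP lq]].
by have := min q rq lq; rewrite size_tuple leqNgt kp.
Qed.

Section SetDist.
Variables (V : finType) (e : rel V) (C : {pred V}) (c0 : V).
Hypothesis e_conn : connected_graph e.
Hypothesis c0C : c0 \in C.

(** Distance from a vertex to the set [C], encoded like [graph_dist]: the least
    length of a path ending in [C], below #|V|. *)
Definition set_dist (x : V) : nat :=
  find (fun k => [exists p : k.-tuple V, path e x p && (last x p \in C)])
       (iota 0 #|V|).

Let reach x k := [exists p : k.-tuple V, path e x p && (last x p \in C)].

Lemma set_dist_spec x :
  exists p, [/\ path e x p, last x p \in C, size p = set_dist x
              & (set_dist x < #|V|)%N].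
Proof.
have ha : has (reach x) (iota 0 #|V|).
  have /connectP[p ep lp] := e_conn x c0.
  case/shortenP: ep lp => p' ep' up' _ lp.
  apply/hasP; exists (size p').
    rewrite mem_iota add0n -[(size p').+1]/(size (x :: p')).
    by rewrite -(card_uniqP up') max_card.
  by rewrite /reach; apply/existsP; exists (in_tuple p'); rewrite ep' -lp.
have lt : (set_dist x < #|V|)%N.
  by rewrite -[X in (_ < X)%N](size_iota 0) -has_find.
have : reach x (set_dist x) by have := nth_find 0%N ha; rewrite nth_iota.
move: lt; rewrite /reach; move: (set_dist x) => m lt /existsP[p /andP[ep lp]].
by exists p; split=> //; rewrite size_tuple.
Qed.

Lemma set_dist_lt x : (set_dist x < #|V|)%N.
Proof. by have [p []] := set_dist_spec x. Qed.

Lemma set_dist_le x p :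
  path e x p -> last x p \in C -> (set_dist x <= size p)%N.
Proof.
move=> ep lp; rewrite leqNgt; apply/negP => lt.
have := before_find 0%N lt.
rewrite nth_iota ?(ltn_trans lt) ?set_dist_lt // => /negbT/negP; apply.
by apply/existsP; exists (in_tuple p); rewrite ep.
Qed.

Lemma set_dist_eq0 x : (set_dist x == 0%N) = (x \in C).
Proof.
apply/eqP/idP => [x0|xC].
  by have [[|w p] [_ //= lp sp _]] := set_dist_spec x; rewrite x0 in sp.
by apply/eqP; rewrite -leqn0; exact: (@set_dist_le x [::]).
Qed.

Lemma set_dist_lip x w : e x w -> (set_dist x <= (set_dist w).+1)%N.
Proof.
move=> exw; have [p [ep lp <- _]] := set_dist_spec w.
by apply: (@set_dist_le x (w :: p)) => //=; rewrite exw.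
Qed.

Lemma set_dist_step x : x \notin C ->
  exists2 w, e x w & (set_dist w).+1 = set_dist x.
Proof.
move=> xNC; have [[|w p] [/= ep lp sp _]] := set_dist_spec x.
  by rewrite lp in xNC.
case/andP: ep => exw ep; exists w => //; apply/eqP.
by rewrite eqn_leq set_dist_lip // andbT -sp ltnS set_dist_le.
Qed.

Lemma set_dist_path (e_sym : symmetric e) x p :
  path e x p -> (set_dist (last x p) <= set_dist x + size p)%N.
Proof.
elim: p x => [|w p IH] x /=; first by rewrite addn0.
case/andP=> exw /IH /leq_trans; apply.
by rewrite addnS -addSn leq_add2r set_dist_lip // e_sym.
Qed.

End SetDist.

(** * Unicyclic graphs as functional graphs *)

(** In a cycle with at least three vertices, two steps do not lead back. *)
Lemma next_next (V : eqType) (c : seq V) (x : V) :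
  uniq c -> (2 < size c)%N -> x \in c -> next c (next c x) != x.
Proof.
move=> uc sc xc; case: (rot_to xc) => i s rc.
rewrite -!(next_rot i uc) rc.
have : (2 < size (rot i c))%N by rewrite size_rot.
have : uniq (rot i c) by rewrite rot_uniq.
rewrite rc; case: s {rc} => [|a [|b s]] //= /and3P[].
rewrite !inE !negb_or => /and3P[xa xb _] _ _ _.
by rewrite eqxx [a == x]eq_sym (negPf xa) eqxx eq_sym.
Qed.

Section Unicyclic.
Variables (V : finType) (e : rel V) (l : nat) (c : l.-tuple V).
Hypothesis hG : unicyclic e.
Hypothesis hc : graph_cycle e c.

Let e_sym : symmetric e. Proof. by case: hG => -[]. Qed.
Let e_irr : irreflexive e. Proof. by case: hG => -[]. Qed.
Let e_conn : connected_graph e. Proof. by case: hG. Qed.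
Let c_uniq : uniq c. Proof. by case: hc => /andP[]. Qed.
Let c_cycle : cycle e c. Proof. by case: hc => /andP[]. Qed.
Let c_size : (2 < size c)%N. Proof. by case: hc. Qed.

Let c_inhab : exists c0, c0 \in c.
Proof.
have l0 : (0 < l)%N by rewrite -(size_tuple c); apply: leq_trans c_size.
by exists (tnth c (Ordinal l0)); exact: mem_tnth.
Qed.

(** Distance to the cycle. *)
Definition height (x : V) : nat := set_dist e (mem c) x.

Lemma height_eq0 x : (height x == 0%N) = (x \in c).
Proof.
by have [c0 c0P] := c_inhab; rewrite /height (set_dist_eq0 e_conn c0P).
Qed.

(** The unicyclic graph as a functional graph: the successor of a vertex of the
    cycle is the next one around the cycle, and that of any other vertex is a
    neighbour closer to the cycle.  The default value is never used. *)
Definition successor (x : V) : V :=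
  if x \in c then next c x
  else odflt x [pick w | e x w & (height w).+1 == height x].

Lemma successor_cycle x : x \in c -> successor x = next c x.
Proof. by rewrite /successor => ->. Qed.

Lemma successor_height x : x \notin c ->
  e x (successor x) /\ (height (successor x)).+1 = height x.
Proof.
move=> xNc; rewrite /successor (negPf xNc); case: pickP => [w /andP[? /eqP]//|].
have [c0 c0P] := c_inhab.
have [w exw hw] := set_dist_step e_conn c0P xNc.
by move=> /(_ w) /=; rewrite exw /height hw eqxx.
Qed.

Lemma successor_edge x : e x (successor x).
Proof.
have [xc|xNc] := boolP (x \in c); last by have [] := successor_height xNc.
by rewrite successor_cycle //; exact: next_cycle.
Qed.

Lemma successor2 x : successor (successor x) != x.
Proof.
have [xc|xNc] := boolP (x \in c).
  by rewrite !successor_cycle ?mem_next // next_next.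
have [_ hx] := successor_height xNc.
have [yc|yNc] := boolP (successor x \in c).
  apply: contraNneq xNc => <-.
  by rewrite (successor_cycle yc) mem_next.
have [_ hy] := successor_height yNc.
by apply/eqP => E; move: hy hx; rewrite E => <-; lia.
Qed.

Lemma successor_edge_inj : injective (fun x => [set x; successor x]%SET).
Proof.
move=> x y E; apply/eqP/negPn/negP => xy.
have : x \in [set y; successor y]%SET by rewrite -E set21.
have : y \in [set x; successor x]%SET by rewrite E set21.
rewrite !inE eq_sym (negPf xy) /= => /eqP -> /eqP Ex.
by have := successor2 x; rewrite -Ex eqxx.
Qed.

(** The edges are exactly the pairs {x, successor x}: these are #|V| distinct
    edges, and a unicyclic graph has no more. *)
Lemma edge_successor x w : e x w = (w == successor x) || (successor w == x).
Proof.
apply/idP/orP => [exw|[/eqP ->|/eqP <-]]; last 2 first.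
- exact: successor_edge.
- by rewrite e_sym successor_edge.
have [_ _ cardE] := hG.
have imE : [set [set z; successor z] | z in V]%SET = edges e.
  apply/eqP; rewrite eqEcard (card_imset _ successor_edge_inj) -cardE leqnn.
  rewrite andbT.
  apply/fintype.subsetP => _ /imsetP[z _ ->].
  apply/imsetP; exists (z, successor z) => //.
  by rewrite inE successor_edge.
have : [set x; w]%SET \in edges e by apply/imsetP; exists (x, w).
rewrite -imE => /imsetP[z _ E].
have : x \in [set z; successor z]%SET by rewrite -E set21.
have : w \in [set z; successor z]%SET by rewrite -E set22.
have xw : x == w = false by apply/eqP => xw; move: exw; rewrite xw e_irr.
rewrite !inE => /orP[]/eqP wz /orP[]/eqP xz; first 1 last.
- by right; rewrite wz xz.
- by left; rewrite wz xz.
- by rewrite wz xz eqxx in xw.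
- by rewrite wz xz eqxx in xw.
Qed.

Lemma big_edge (M : nmodType) (F : V -> M) x :
  \sum_(w | e x w) F w = F (successor x) + \sum_(w | successor w == x) F w.
Proof.
rewrite (bigD1 (successor x)) ?successor_edge //=; congr (_ + _).
apply: eq_bigl => w; rewrite edge_successor andb_orl andbN /=.
have [wx|//] := eqVneq w (successor x); last by rewrite andbT.
by rewrite andbF wx (negPf (successor2 x)).
Qed.

Lemma sum_successor_cycle x :
  (\sum_(w | successor w == x) (w \in c) = (x \in c))%N.
Proof.
have [xc|xNc] := boolP (x \in c); last first.
  rewrite big1 // => w /eqP wx; case: (boolP (w \in c)) => // wc.
  by move: xNc; rewrite -wx successor_cycle // mem_next wc.
have pc : prev c x \in c by rewrite mem_prev.
rewrite (bigD1 (prev c x)) /=; last by rewrite successor_cycle // next_prev.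
rewrite pc big1 ?addn0 // => w /andP[/eqP wx wp].
case: (boolP (w \in c)) => // wc; case/eqP: wp.
by rewrite -wx successor_cycle // prev_next.
Qed.

(** Seen from [x], the successor is at height one less and its preimages at
    height one more, except along the cycle, where the height is constant. *)
Lemma laplacian_height (R : realType) x :
  laplacian e (fun z => (height z)%:R : R) x = 2%:R - (degree e x)%:R.
Proof.
have stepE z :
    (height z)%:R - (height (successor z))%:R = 1 - (z \in c)%:R :> R.
  have [zc|zNc] := boolP (z \in c).
    have := height_eq0 z; rewrite zc => /eqP ->.
    have := height_eq0 (successor z); rewrite successor_cycle // mem_next zc.
    by move=> /eqP ->; rewrite !subrr.
  by have [_ <-] := successor_height zNc; rewrite -natr1 /=; ring.
rewrite /laplacian big_edge stepE.
have degE : (degree e x)%:R = 1 + \sum_(w | successor w == x) 1 :> R.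
  by rewrite -(big_edge (fun=> 1 : R)) sumr_const /degree cardsE.
rewrite degE (eq_bigr (fun w => (w \in c)%:R - 1)); last first.
  by move=> w /eqP <-; rewrite -opprB stepE opprB.
by rewrite sumrB -natr_sum sum_successor_cycle; ring.
Qed.

(** The vertex of the cycle reached by iterating [successor]. *)
Definition root_of (x : V) : V := iter (height x) successor x.

(** The graph without the edges of its cycle. *)
Let del := delete_edges e (cycle_edges c).

Lemma del_sym : symmetric del.
Proof. by move=> x y; rewrite /del /delete_edges /= e_sym finset.setUC. Qed.

Lemma del_successor x : x \notin c -> del x (successor x).
Proof.
move=> xNc; rewrite /del /delete_edges /= successor_edge /=.
apply/imsetP => -[z zc E].
have : x \in [set z; next c z]%SET by rewrite -E set21.
rewrite !inE => /orP[]/eqP xz; move: xNc; rewrite xz ?zc //.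
by rewrite mem_next zc.
Qed.

Lemma root_successor x : x \notin c -> root_of (successor x) = root_of x.
Proof.
move=> xNc; rewrite /root_of; have [_ <-] := successor_height xNc.
by rewrite iterSr.
Qed.

Lemma root_cycle x : x \in c -> root_of x = x.
Proof. by rewrite -height_eq0 /root_of => /eqP ->. Qed.

Lemma root_del x w : del x w -> root_of x = root_of w.
Proof.
wlog -> : x w / w = successor x => [H|] dxw.
  have := dxw; rewrite /del /delete_edges /= edge_successor.
  move=> /andP[/orP[]/eqP E _].
    exact: H.
  by symmetry; apply: H => //; rewrite -/del del_sym.
have [xc|xNc] := boolP (x \in c); last by rewrite root_successor.
case/andP: dxw => _ /imsetP[]; exists x => //.
by rewrite successor_cycle.
Qed.

Lemma path_to_root x :
  exists p, [/\ path del x p, last x p = root_of x & size p = height x].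
Proof.
elim: {x}(height x) {-2}x (erefl (height x)) => [|m IH] x hx.
  by exists [::]; rewrite root_cycle // -height_eq0 hx.
have xNc : x \notin c by rewrite -height_eq0 hx.
have [_ hs] := successor_height xNc.
have [|p [dp lp sp]] := IH (successor x); first by move: hs; rewrite hx => -[].
exists (successor x :: p) => /=.
by rewrite del_successor // dp lp root_successor // sp hs.
Qed.

Lemma root_in_cycle x : root_of x \in c.
Proof.
elim: {x}(height x) {-2}x (erefl (height x)) => [|m IH] x hx.
  by rewrite root_cycle // -height_eq0 hx.
have xNc : x \notin c by rewrite -height_eq0 hx.
have [_ hs] := successor_height xNc.
by rewrite -root_successor // IH //; move: hs; rewrite hx => -[].
Qed.

Lemma mem_tree_verts (i : 'I_l) x :
  (x \in tree_verts e c i) = (root_of x == tnth c i).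
Proof.
rewrite inE -/del; apply/idP/eqP => [/connectP[p dp lp]|rx].
  transitivity (root_of (tnth c i)); last exact/root_cycle/mem_tnth.
  elim: p (tnth c i) dp lp => [_ _ -> //|w p IH z] /= /andP[/root_del -> dp] lp.
  exact: IH.
rewrite (sym_connect_sym del_sym); have [p [dp lp _]] := path_to_root x.
by apply/connectP; exists p; rewrite // lp.
Qed.

Lemma height_lt x : (height x < #|V|)%N.
Proof. by have [c0 c0P] := c_inhab; exact: (set_dist_lt e_conn c0P). Qed.

Lemma graph_dist_root (i : 'I_l) x :
  x \in tree_verts e c i -> graph_dist e x (tnth c i) = height x.
Proof.
rewrite mem_tree_verts => /eqP rx; have [p [dp lp sp]] := path_to_root x.
have [c0 c0P] := c_inhab.
rewrite -sp; apply: graph_distE; rewrite ?lp ?sp ?height_lt //.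
  by apply: sub_path dp => y z /andP[].
move=> q eq lq; apply: (set_dist_le e_conn c0P) => //.
by rewrite lq; exact: mem_tnth.
Qed.

Lemma graph_dist_tree (i : 'I_l) x :
    x \in tree_verts e c i ->
  graph_dist (tree_rel e c i) (tnth c i) x = height x.
Proof.
move=> xi; have := xi; rewrite mem_tree_verts => /eqP rx.
have [p [dp lp sp]] := path_to_root x.
have [c0 c0P] := c_inhab.
pose q := rev (belast x p).
have sq : size q = height x by rewrite size_rev size_belast.
have lq : last (tnth c i) q = x.
  rewrite /q; case: (p) lp => [|a s] /= => [->//|].
  by rewrite rev_cons last_rcons.
have dq : path del (tnth c i) q.
  by rewrite -rx -lp rev_path; apply: sub_path dp => y z; rewrite del_sym.
have closed y z : y \in tree_verts e c i -> del y z -> z \in tree_verts e c i.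
  by rewrite !mem_tree_verts => /eqP <- /root_del ->.
have tq : path (tree_rel e c i) (tnth c i) q.
  have : tnth c i \in tree_verts e c i.
    by rewrite mem_tree_verts root_cycle // mem_tnth.
  elim: (q) (tnth c i) dq => //= w s IH y /andP[dy ds] yi.
  have wi := closed _ _ yi dy.
  by rewrite IH // andbT; apply/and3P; split.
rewrite -sq; apply: graph_distE => //; first by rewrite sq height_lt.
move=> s ts ls.
have es : path e (tnth c i) s by apply: sub_path ts => y z /and3P[_ _ /andP[]].
have := set_dist_path e_conn c0P e_sym es; rewrite ls -/(height x).
have /eqP : height (tnth c i) == 0%N by rewrite height_eq0 mem_tnth.
by rewrite /height sq => ->.
Qed.

Lemma sum_dist_sum :
  (\sum_(i < l) dist_sum (tree_verts e c i) (tree_rel e c i) (tnth c i)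
   = \sum_x height x)%N.
Proof.
rewrite /dist_sum.
rewrite (eq_bigr (fun i => \sum_(x in tree_verts e c i) height x)%N);
  last first.
  by move=> i _; apply: eq_bigr => x xi; rewrite graph_dist_tree.
rewrite (exchange_big_dep predT) //=; apply: eq_bigr => x _.
have /tnthP[i ri] := root_in_cycle x.
rewrite (big_pred1 i) // => j.
rewrite mem_tree_verts ri /= eq_sym; apply/eqP/eqP => [E|-> //].
by apply: (tuple_uniqP _ c_uniq).
Qed.

End Unicyclic.

(** * Expected hitting times of the simple random walk *)

Section FinitePartition.
Local Open Scope classical_set_scope.
Context (R : realType) (d : measure_display) (Omega : measurableType d).
Variable (P : probability Omega R).

(** Probability as a real number. *)
Definition prob (A : set Omega) : R := fine (P A).

Lemma probK A : measurable A -> P A = (prob A)%:E.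
Proof. by move=> mA; rewrite /prob fineK // fin_num_measure. Qed.

Lemma prob_ge0 A : 0 <= prob A.
Proof. by rewrite fine_ge0. Qed.

Lemma prob_partition (T : finType) (F : Omega -> T) A :
    measurable A -> (forall t, measurable [set w | F w = t]) ->
  prob A = \sum_t prob (A `&` [set w | F w = t]).
Proof.
move=> mA mF; apply: EFin_inj; rewrite -probK // -sumEFin.
have mAF t : measurable (A `&` [set w | F w = t]) by exact: measurableI.
transitivity (\sum_t P (A `&` [set w | F w = t]))%E; last first.
  by apply: eq_bigr => t _; rewrite probK.
rewrite fsbig_seq ?index_enum_uniq // -measure_fin_bigcup //.
- congr (P _); apply/seteqP; split=> [w Aw|w [t _ []//]].
  by exists (F w) => //=; rewrite mem_index_enum.
- by move=> s t _ _ [w [[_ /= <-] [_ /= <-]]].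
Qed.

End FinitePartition.

Section HittingTime.
Local Open Scope classical_set_scope.
Context (R : realType) (V : finType) (Omega : Type).
Variables (X : nat -> Omega -> V) (y : V).

(** The event T_y > k. *)
Definition survival (k : nat) : set Omega :=
  [set w | forall i, (i <= k)%N -> X i w != y].

(** T_y is the sum over k of the indicators of T_y > k, also when T_y is
    infinite. *)
Lemma hitting_time_series w :
  hitting_time R X y w = (\sum_(k <oo) (\1_(survival k) w)%:E)%E.
Proof.
have [hit|nohit] := pselect (exists k, X k w == y).
- case: (ex_minnP hit) => m /eqP Xm min.
  have surv k : (\1_(survival k) w : R) = (k < m)%N%:R.
    rewrite indicE; congr (_%:R); congr (nat_of_bool _).
    apply/idP/idP => [|km].
      rewrite inE => sk; rewrite ltnNge; apply/negP => mk.
      by have := sk m mk; rewrite Xm eqxx.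
    rewrite inE => i ik; apply/negP => /min; lia.
  have sumE n : (m <= n)%N ->
      (\sum_(0 <= k < n) (\1_(survival k) w)%:E = m%:R%:E :> \bar R)%E.
    move=> mn; rewrite sumEFin; congr (_%:E).
    rewrite (big_cat_nat (leq0n m) mn) /= [X in _ + X]big1_seq ?addr0.
      rewrite (eq_big_nat _ _ (F2 := fun=> 1)); last first.
        by move=> k /andP[_ km]; rewrite surv km.
      by rewrite sumr_const_nat subn0.
    move=> k /andP[_]; rewrite mem_index_iota => /andP[mk _].
    by rewrite surv ltnNge mk.
  transitivity (m%:R%:E : \bar R).
    apply/eqP; rewrite eq_le; apply/andP; split.
      by apply: ereal_inf_lbound; exists m.
    apply: le_ereal_inf_tmp => _ [k Xk <-]; rewrite lee_fin ler_nat.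
    by apply: min; apply/eqP.
  symmetry; apply: lim_near_cst => //.
  by exists m => // n /= mn; exact: sumE.
- rewrite /hitting_time.
  have -> : [set (k%:R)%:E | k in [set k : nat | X k w = y]] = set0
      :> set (\bar R).
    apply/seteqP; split=> // u [k Xk _]; apply: nohit.
    by exists k; apply/eqP.
  rewrite ereal_inf0; apply/esym/eqyP => A A0.
  have [n An] : exists n, A <= n%:R.
    by exists (Num.truncn A).+1; apply/ltW; exact: truncnS_gt.
  apply: (@le_trans _ _ n%:R%:E); first by rewrite lee_fin.
  rewrite -[n%:R%:E](_ : \sum_(0 <= k < n) (\1_(survival k) w)%:E = _)%E.
    by apply: nneseries_lim_ge => k _ _; rewrite lee_fin.
  rewrite sumEFin; congr (_%:E).
  rewrite (eq_bigr (fun=> 1)) ?sumr_const_nat ?subn0 // => k _.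
  rewrite indicE mem_set // => i _; apply/negP => Xi; apply: nohit.
  by exists i.
Qed.

End HittingTime.

Section Walk.
Local Open Scope classical_set_scope.
Context (R : realType) (V : finType) (e : rel V).
Context (d : measure_display) (Omega : measurableType d).
Variables (P : probability Omega R) (X : nat -> Omega -> V) (x : V).
Hypothesis hX : simple_random_walk e P X x.

Let mX k z : measurable [set w | X k w = z].
Proof. by case: hX => mX _ _; exact: mX. Qed.

(** The event that the walk follows [s] up to time [k]. *)
Let cylinder k (s : nat -> V) : set Omega :=
  [set w | forall i, (i <= k)%N -> X i w = s i].

Lemma measurable_forall_le (A : nat -> set Omega) k :
  (forall i, measurable (A i)) ->
  measurable [set w | forall i, (i <= k)%N -> A i w].
Proof. by move=> mA; apply: bigcap_measurableType => i _; exact: mA. Qed.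

Let m_cylinder k s : measurable (cylinder k s).
Proof.
by apply: (@measurable_forall_le (fun i => [set w | X i w = s i])) => i.
Qed.

Lemma prob_cylinderS k s :
  prob P (cylinder k.+1 s)
  = prob P (cylinder k s) * transition R e (s k) (s k.+1).
Proof.
apply: EFin_inj; rewrite EFinM -!probK //.
by case: hX => _ _; exact.
Qed.

(** The trajectory of the walk up to time [k]. *)
Let trajectory k (w : Omega) : {ffun 'I_k.+1 -> V} :=
  [ffun i : 'I_k.+1 => X i w].

(** The infinite trajectory that follows [t] up to time [k] and then stays at
    [z]. *)
Let extend k (t : {ffun 'I_k.+1 -> V}) (z : V) (i : nat) : V :=
  if (i <= k)%N then t (inord i) else z.

Lemma trajectoryE k t z :
  [set w | trajectory k w = t] = cylinder k (extend t z).
Proof.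
apply/seteqP; split=> w /=.
  by move=> <- i ik; rewrite /extend ik ffunE inordK.
move=> tw; apply/ffunP => i; have ik : (i <= k)%N by rewrite -ltnS.
by rewrite ffunE tw // /extend ik inord_val.
Qed.

Lemma m_trajectory k t : measurable [set w | trajectory k w = t].
Proof. by rewrite (trajectoryE t x). Qed.

(** The Markov property at time [k], for an event [Q] that depends on the
    trajectory up to time [k]. *)
Lemma markov_step k (Q : pred {ffun 'I_k.+1 -> V}) v z :
  measurable [set w | Q (trajectory k w)] ->
  prob P ([set w | Q (trajectory k w)] `&` [set w | X k w = v]
          `&` [set w | X k.+1 w = z])
  = prob P ([set w | Q (trajectory k w)] `&` [set w | X k w = v])
    * transition R e v z.
Proof.
move=> mQ.
(* Both sides are summed over the trajectories [t] up to time [k]. *)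
rewrite (prob_partition P _ (@m_trajectory k)); last first.
  by do 2?apply: measurableI.
rewrite [X in _ = X * _](prob_partition P _ (@m_trajectory k)); last first.
  exact: measurableI.
rewrite mulr_suml; apply: eq_bigr => t _.
have tk w : trajectory k w = t -> X k w = t ord_max by move=> <-; rewrite ffunE.
have [/andP[Qt /eqP tv]|Nt] := boolP (Q t && (t ord_max == v)); last first.
  have null A : A `<=` [set w | Q (trajectory k w)] `&` [set w | X k w = v] ->
      A `&` [set w | trajectory k w = t] = set0.
    move=> sub; apply/seteqP; split=> // w [/sub[/= Qw Xv] /= tw]; move: Nt.
    by rewrite -(tk w tw) -tw Qw Xv eqxx.
  by rewrite !null // /prob ?measure0 ?mul0r // => w [].
have -> : [set w | Q (trajectory k w)] `&` [set w | X k w = v] `&`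
   [set w | trajectory k w = t] = cylinder k (extend t z).
  rewrite -trajectoryE; apply/seteqP; split=> w /= => [[]//|tw].
  by rewrite (tk w tw) tv tw Qt.
have -> : [set w | Q (trajectory k w)] `&` [set w | X k w = v] `&`
   [set w | X k.+1 w = z] `&` [set w | trajectory k w = t]
   = cylinder k.+1 (extend t z).
  apply/seteqP; split=> w /=.
    move=> [[_ Xz]]; rewrite -[_ = t]/([set w | trajectory k w = t] w).
    rewrite (trajectoryE t z) => tw i; rewrite leq_eqVlt => /orP[/eqP ->|].
      by rewrite /extend ltnn.
    by rewrite ltnS; exact: tw.
  move=> cw.
  have tw : trajectory k w = t.
    rewrite -[_ = t]/([set w | trajectory k w = t] w) (trajectoryE t z).
    by move=> i ik; apply: cw; exact: leqW.
  rewrite (tk w tw) tv tw Qt (cw k.+1) //; split=> //; split=> //.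
  by rewrite /extend ltnn.
rewrite prob_cylinderS; congr (_ * transition _ _ _ _).
  rewrite /extend leqnn -tv; congr (t _).
  by apply: val_inj; rewrite /= inordK.
by rewrite /extend ltnn.
Qed.

Section Hitting.
Variables (y : V) (h : V -> R).
Hypothesis e_conn : connected_graph e.
Hypothesis hh : hitting_potential e y h.

Let S := survival X y.

Let m_survival k : measurable (S k).
Proof.
apply: (@measurable_forall_le (fun i => [set w | X i w != y])) => i.
rewrite (_ : [set _ | _] = ~` [set w | X i w = y]); first exact: measurableC.
by apply/seteqP; split=> w /= /eqP.
Qed.

(** The probability of T_y > k and X_k = z. *)
Let b k z : R := prob P (S k `&` [set w | X k w = z]).

Lemma survivalS k : S k.+1 = S k `&` [set w | X k.+1 w != y].
Proof.
apply/seteqP; split=> w /=.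
  by move=> Sw; split=> [i ik|]; apply: Sw => //; exact: leqW.
move=> [Sw Xy] i; rewrite leq_eqVlt => /orP[/eqP -> //|]; rewrite ltnS.
exact: Sw.
Qed.

Lemma survival_step k z : z != y ->
  b k.+1 z = \sum_v b k v * transition R e v z.
Proof.
move=> zy; rewrite /b (prob_partition P _ (mX k)); last exact: measurableI.
apply: eq_bigr => v _.
pose Q := [pred t : {ffun 'I_k.+1 -> V} | [forall i, t i != y]].
have SE : S k = [set w | Q (trajectory k w)].
  apply/seteqP; split=> w /=.
    by move=> Sw; apply/forallP => i; rewrite ffunE Sw // -ltnS.
  move=> /forallP Sw i ik; have := Sw (inord i).
  by rewrite ffunE inordK.
have := @markov_step k Q v z; rewrite -SE => <- //; congr (prob P _).
rewrite survivalS; apply/seteqP; split=> w /=.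
  by move=> [[[Sw _] Xz] Xv].
by move=> [[Sw Xv] Xz]; rewrite Xz.
Qed.

Lemma survival_at_target k : b k y = 0.
Proof.
rewrite /b (_ : _ `&` _ = set0) ?/prob ?measure0 //.
apply/seteqP; split=> // w [Sw /= Xy].
by have := Sw k (leqnn k); rewrite Xy eqxx.
Qed.

Lemma degree_gt0 v : v != y -> (0 < degree e v)%N.
Proof.
move=> vy; have /connectP[[|w p] /= ep lp] := e_conn v y.
  by rewrite lp eqxx in vy.
by case/andP: ep => evw _; apply/card_gt0P; exists w; rewrite inE.
Qed.

Lemma transition_hitting v : v != y ->
  \sum_z transition R e v z * h z = h v - 1.
Proof.
move=> vy; case: hh => hy hL h0; have := hL v vy; rewrite laplacianE.
have dv : (degree e v)%:R != 0 :> R by rewrite pnatr_eq0 -lt0n degree_gt0.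
move=> E; have -> : \sum_z transition R e v z * h z
    = (degree e v)%:R^-1 * \sum_(w | e v w) h w.
  rewrite mulr_sumr [RHS]big_mkcond; apply: eq_bigr => z _.
  by rewrite /transition; case: (e v z); rewrite ?mul1r // !mul0r.
have -> : \sum_(w | e v w) h w = (degree e v)%:R * h v - (degree e v)%:R.
  by lra.
by field.
Qed.

(** The expected remaining time to reach [y] after time [k], on the event
    T_y > k. *)
Let M k : R := \sum_z b k z * h z.

Lemma remaining_time0 : M 0%N = h x.
Proof.
case: hX => _ X0 _; case: hh => hy _ _.
have mXx := mX 0 x.
rewrite /M (bigD1 x) //= big1 ?addr0 => [|z zx]; last first.
  suff -> : b 0%N z = 0 by rewrite mul0r.
  have sub : S 0%N `&` [set w | X 0%N w = z] `<=` ~` [set w | X 0%N w = x].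
    by move=> w [_ /= ->]; exact/eqP.
  apply: EFin_inj; rewrite -probK; last exact: measurableI.
  apply/eqP; rewrite eq_le measure_ge0 andbT.
  have PC : P (~` [set w | X 0%N w = x]) = 0%E.
    by rewrite probability_setC // X0 subee.
  rewrite -[X in (_ <= X)%E]PC; apply: le_measure => //; rewrite inE.
    exact: measurableI.
  exact: measurableC.
have [->|xy] := eqVneq x y; first by rewrite hy mulr0.
rewrite /b (_ : _ `&` _ = [set w | X 0%N w = x]).
  by rewrite /prob X0 mul1r.
apply/seteqP; split=> w /=; first by case.
move=> X0x; split=> // i; rewrite leqn0 => /eqP ->.
by rewrite X0x.
Qed.

Lemma prob_survival k : prob P (S k) = \sum_z b k z.
Proof. by rewrite (prob_partition P _ (mX k)). Qed.

Lemma remaining_timeS k : M k.+1 = M k - prob P (S k).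
Proof.
have [hy _ _] := hh.
rewrite /M prob_survival.
rewrite (eq_bigr (fun z => \sum_v b k v * (transition R e v z * h z))).
  rewrite exchange_big -sumrB; apply: eq_bigr => v _ /=.
  rewrite -mulr_sumr; have [->|vy] := eqVneq v y.
    by rewrite survival_at_target !mul0r subr0.
  by rewrite transition_hitting // mulrBr mulr1.
move=> z _; have [->|zy] := eqVneq z y.
  by rewrite hy mulr0 big1 // => v _; rewrite !mulr0.
by rewrite survival_step // mulr_suml; apply: eq_bigr => v _; rewrite mulrA.
Qed.

(** The one-step equations of [h] telescope. *)
Lemma sum_survival n : \sum_(0 <= k < n) prob P (S k) = h x - M n.
Proof.
elim: n => [|n IH]; first by rewrite big_nil remaining_time0 subrr.
by rewrite big_nat_recr //= IH remaining_timeS; ring.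
Qed.

Lemma remaining_time_ge0 k : 0 <= M k.
Proof.
case: hh => _ _ h0; apply: sumr_ge0 => z _.
by rewrite mulr_ge0 // prob_ge0.
Qed.

Lemma remaining_time_le k : M k <= prob P (S k) * \sum_z h z.
Proof.
case: hh => _ _ h0; rewrite prob_survival mulr_suml; apply: ler_sum => z _.
apply: ler_wpM2l; first exact: prob_ge0.
by rewrite (bigD1 z) //= lerDl sumr_ge0.
Qed.

Lemma cvg_sum_survival : series (fun k => prob P (S k)) @ \oo --> h x.
Proof.
(* The partial sums are bounded by [h x], so the series converges and
   P(T_y > k) tends to 0; [M k] is at most a constant times P(T_y > k). *)
have cvgS : cvgn (series (fun k => prob P (S k))).
  apply: nondecreasing_is_cvgn.
    by apply: nondecreasing_series => k _ _; exact: prob_ge0.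
  exists (h x) => _ [n _ <-]; rewrite /series /= sum_survival.
  by rewrite lerBlDr lerDl remaining_time_ge0.
have S0 : (fun k => prob P (S k) * \sum_z h z) @ \oo --> 0.
  rewrite -[X in _ --> X](mul0r (\sum_z h z)); apply: cvgM; last exact: cvg_cst.
  exact: cvg_series_cvg_0.
have M0 : M @ \oo --> 0.
  apply: (squeeze_cvgr _ (cvg_cst 0) S0); apply: nearW => k.
  by rewrite remaining_time_ge0 remaining_time_le.
rewrite (_ : series _ = fun n => h x - M n).
  by rewrite -[X in _ --> X]subr0; apply: cvgB => //; exact: cvg_cst.
by apply/funext => n; rewrite /series /= sum_survival.
Qed.

(** The expected hitting time is the hitting potential; in particular it is
    finite. *)
Lemma integral_hitting_time :
  (\int[P]_w hitting_time R X y w = (h x)%:E)%E.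
Proof.
under eq_integral do rewrite hitting_time_series.
rewrite integral_nneseries //; last first.
  by move=> k; apply/measurable_EFinP; exact: measurable_indic.
rewrite (eq_eseriesr (g := fun k => (prob P (S k))%:E)); last first.
  by move=> k _; rewrite integral_indic // setIT; exact: probK.
apply/cvg_lim => //.
rewrite (_ : (fun n => _) = EFin \o series (fun k => prob P (S k))).
  by apply: cvg_EFin; [exact: nearW | exact: cvg_sum_survival].
by apply/funext => n; rewrite /= /series /= sumEFin.
Qed.

End Hitting.
End Walk.

(** * Cover costs *)

(** Sum over ordered pairs as twice the sum over unordered pairs. *)
Lemma sum_sym_pairs (R : realType) (V : finType) (F : V -> V -> R) :
    (forall x y, F x y = F y x) -> (forall x, F x x = 0) ->
  \sum_x \sum_y F x y
  = 2 * \sum_(p : V * V | (enum_rank p.1 < enum_rank p.2)%N) F p.1 p.2.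
Proof.
move=> F_sym F_diag; rewrite pair_bigA /=.
rewrite (bigID (fun p : V * V => (enum_rank p.1 < enum_rank p.2)%N)) /=.
rewrite mulr_natl mulr2n; congr (_ + _).
rewrite (bigID (fun p : V * V => p.1 == p.2)) /= big1 ?add0r; last first.
  by move=> [x y] /= /andP[_ /eqP ->].
have swapK : involutive (fun p : V * V => (p.2, p.1)) by case.
rewrite (reindex_inj (inv_inj swapK)) /=.
apply: eq_big => [[x y] /=|[x y] _]; last exact: F_sym.
rewrite -leqNgt ltn_neqAle andbC (inj_eq val_inj) (inj_eq enum_rank_inj).
by rewrite eq_sym.
Qed.

Section UnicyclicCosts.
Variables (R : realType) (V : finType) (e : rel V) (l : nat) (c : l.-tuple V).
Hypothesis hG : unicyclic e.
Hypothesis hc : graph_cycle e c.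

Let e_sym : symmetric e. Proof. by case: hG => -[]. Qed.
Let e_conn : connected_graph e. Proof. by case: hG. Qed.

Lemma sum_degree : \sum_z (degree e z)%:R = 2 * #|V|%:R :> R.
Proof.
have := sum_laplacian e_sym (fun z => (height e c z)%:R : R).
rewrite (eq_bigr _ (fun z _ => laplacian_height hG hc R z)) sumrB sumr_const.
by rewrite -[X in X - _]mulr_natr => /subr0_eq ->.
Qed.

Variable h : V -> V -> R.
Hypothesis hh : forall y, hitting_potential e y (h y).

Let n : R := #|V|%:R.

Lemma commute_time_unicyclic x y : h y x + h x y = 2 * n * resistance R e x y.
Proof. by rewrite (commute_time e_sym e_conn (hh x) (hh y)) sum_degree. Qed.

Lemma laplacian_cover x :
  laplacian e (fun z => \sum_y h y z) x = n * (degree e x)%:R - 2 * n.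
Proof.
rewrite laplacian_sum.
rewrite (eq_bigr _ (fun y _ => laplacian_hitting e_sym (hh y) x)).
rewrite sumrB sumr_const.
rewrite -[X in X - _]mulr_natl -mulr_suml (bigD1 x) //= eqxx big1 ?addr0.
  by rewrite mul1r sum_degree.
by move=> y; rewrite eq_sym => /negPf ->.
Qed.

(** CC + n * height is harmonic, hence a constant; summing over the vertices
    gives its value. *)
Lemma cover_sum x :
  \sum_y h y x
  = 2 * kirchhoff_index R e + \sum_z (height e c z)%:R - n * (height e c x)%:R.
Proof.
have n_neq0 : n != 0 by rewrite pnatr_eq0 -lt0n; apply/card_gt0P; exists x.
pose g z : R := \sum_y h y z + n * (height e c z)%:R.
have g_const z : g z = g x.
  apply: (@harmonic_const R V e e_conn) => w.
  rewrite laplacianD laplacianZ laplacian_cover (laplacian_height hG hc).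
  by rewrite /n; ring.
have sum_g : \sum_z g z = n * g x.
  by rewrite (eq_bigr _ (fun z _ => g_const z)) sumr_const -[LHS]mulr_natl.
have r_sym y z : resistance R e y z = resistance R e z y.
  apply: (mulfI (_ : 2 * n != 0)); first by rewrite mulf_neq0 // pnatr_eq0.
  by rewrite -!commute_time_unicyclic addrC.
have r_diag y : resistance R e y y = 0.
  apply: (mulfI (_ : 2 * n != 0)); first by rewrite mulf_neq0 // pnatr_eq0.
  rewrite -commute_time_unicyclic mulr0.
  by case: (hh y) => -> _ _; rewrite addr0.
have sum_h : \sum_z \sum_y h y z = 2 * n * kirchhoff_index R e.
  have E : \sum_z \sum_y h y z = \sum_z \sum_y h z y by rewrite exchange_big.
  have : \sum_z \sum_y h y z + \sum_z \sum_y h z y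
         = 2 * n * (2 * kirchhoff_index R e).
    rewrite -sum_sym_pairs // mulr_sumr -big_split; apply: eq_bigr => z _ /=.
    rewrite mulr_sumr -big_split; apply: eq_bigr => y _ /=.
    exact: commute_time_unicyclic.
  by rewrite -E; lra.
move: sum_g; rewrite big_split /= sum_h -mulr_sumr => sum_g.
have : g x = 2 * kirchhoff_index R e + \sum_z (height e c z)%:R.
  by apply: (mulfI n_neq0); rewrite -sum_g; ring.
by rewrite /g; lra.
Qed.

Lemma reverse_cover_sum x :
  \sum_y h x y = 2 * n * resistance_sum R e x - \sum_y h y x.
Proof.
rewrite /resistance_sum mulr_sumr -sumrB; apply: eq_bigr => y _.
by rewrite -commute_time_unicyclic; ring.
Qed.

End UnicyclicCosts.

Theorem theorem1p1 (R : realType) (V : finType) (e : rel V) (n l : nat)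
    (hG : unicyclic e) (hn : #|V| = n)
    (c : l.-tuple V) (hc : graph_cycle e c)
    (d : measure_display) (Omega : measurableType d)
    (P : V -> probability Omega R) (X : V -> nat -> Omega -> V)
    (hX : forall y : V, simple_random_walk e (P y) (X y) y)
    (k : 'I_l) (x : V) (hx : x \in tree_verts e c k) :
  cover_cost P X x =
    (2%:R * kirchhoff_index R e
     + \sum_(i < l)
         (dist_sum (tree_verts e c i) (tree_rel e c i) (tnth c i))%:R
     - n%:R * (graph_dist e x (tnth c k))%:R)%:E
  /\
  reverse_cover_cost P X x =
    (2%:R * n%:R * resistance_sum R e x
     - 2%:R * kirchhoff_index R e
     - \sum_(i < l)
         (dist_sum (tree_verts e c i) (tree_rel e c i) (tnth c i))%:R
     + n%:R * (graph_dist e x (tnth c k))%:R)%:E.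
Proof.
have [_ e_conn _] := hG.
have /choice[h hh] := @hitting_potential_exists R V e e_conn.
have hitE y z : expected_hitting P X y z = (h z y)%:E.
  by rewrite /expected_hitting (integral_hitting_time (hX y) e_conn (hh z)).
have distE : \sum_(i < l)
      (dist_sum (tree_verts e c i) (tree_rel e c i) (tnth c i))%:R
    = \sum_z (height e c z)%:R :> R.
  by rewrite -!natr_sum (sum_dist_sum hG hc).
rewrite distE (graph_dist_root hG hc hx) -hn.
have coverE := cover_sum hG hc hh x.
split.
  rewrite /cover_cost (eq_bigr _ (fun y _ => hitE x y)) sumEFin.
  by congr (_%:E).
rewrite /reverse_cover_cost (eq_bigr _ (fun y _ => hitE y x)) sumEFin.
congr (_%:E); rewrite (reverse_cover_sum hG hc hh) coverE.
ring.
Qed.
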